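(* Let $n,b$ be natural numbers with $1<n<b$, let $k\ge 0$, and let $\sigma,\tau,\pi$ be permutations of $\{0,1,\ldots,k\}$. Let $(d_k,\ldots,d_0)_b$ be an $(n,b,\sigma)$-permutiple with carries $c_k,\ldots,c_0$, and let $(d_{\pi(k)},d_{\pi(k-1)},\ldots,d_{\pi(0)})_b$ be an $(n,b,\tau)$-permutiple with carries $\hat{c}_k,\hat{c}_{k-1},\ldots,\hat{c}_0$. If $n$ divides $b$, then $\hat{c}_j=c_{\pi(j)}$ for all $0\le j\le k$.
   Context: For integers $0\le d_j<b$, $(d_k,d_{k-1},\ldots,d_0)_b$ denotes the natural number $\sum_{j=0}^k d_j b^j$ (leading zeros are allowed). For a permutation $\sigma$ of $\{0,1,\ldots,k\}$, $(d_k,\ldots,d_0)_b$ is an $(n,b,\sigma)$-permutiple if $(d_k,d_{k-1},\ldots,d_0)_b = n\,(d_{\sigma(k)},d_{\sigma(k-1)},\ldots,d_{\sigma(0)})_b$. Accordingly, $(d_{\pi(k)},\ldots,d_{\pi(0)})_b$ is an $(n,b,\tau)$-permutiple if $(d_{\pi(k)},\ldots,d_{\pi(0)})_b=n\,(d_{\pi\tau(k)},\ldots,d_{\pi\tau(0)})_b$. The carries of an $(n,b,\sigma)$-permutiple $(d_k,\ldots,d_0)_b$ are those of the usual single-digit multiplication of $(d_{\sigma(k)},\ldots,d_{\sigma(0)})_b$ by $n$ in base $b$: $c_0=0$ and $c_{j+1}=\left[n d_{\sigma(j)}+c_j-\lambda(n d_{\sigma(j)}+c_j)\right]/b$ for $0\le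 j\le k$, where $\lambda(x)$ is the least non-negative residue of $x$ modulo $b$; since the product has $k+1$ digits, $c_{k+1}=0$. (For the permuted number, $d_{\sigma(j)}$ is replaced by $d_{\pi\tau(j)}$.) Products of permutations are compositions, applied right to left. *)

(* Defs.v *)
From mathcomp Require Import all_boot all_fingroup.
Set Implicit Arguments.
Unset Strict Implicit.
Unset Printing Implicit Defensive.

(* (d_k, ..., d_0)_b, with [d j] the digit of weight b ^ j. *)
Definition digits_value (b k : nat) (d : 'I_k.+1 -> 'I_b) : nat :=
  \sum_(j < k.+1) d j * b ^ j.

Definition permutiple (n b k : nat) (s : 'S_k.+1) (d : 'I_k.+1 -> 'I_b) : Prop :=
  digits_value d = n * digits_value (fun j => d (s j)).

(* Carries of the single-digit multiplication of (e_k, ..., e_0)_b by n. Only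
   the indices j <= k.+1 are meaningful: [inord i] is the index i for i <= k. *)
Fixpoint mul_carry (n b k : nat) (e : 'I_k.+1 -> 'I_b) (j : nat) : nat :=
  if j is i.+1 then
    let x := n * e (inord i) + mul_carry n e i in (x - x %% b) %/ b
  else 0.

(* The number being multiplied by n is the permuted one, (d_(s k), ..., d_(s 0))_b. *)
Definition permutiple_carry (n b k : nat) (s : 'S_k.+1) (d : 'I_k.+1 -> 'I_b)
    (j : nat) : nat :=
  mul_carry n (fun i => d (s i)) j.

(* Main.v *)
Require Import Defs.
From mathcomp Require Import all_boot all_fingroup.
Set Implicit Arguments.
Unset Strict Implicit.
Unset Printing Implicit Defensive.

(** When [n] divides [b], a carry can be read off from a single digit of the
    product.  Let [e] be the digits of the multiplicand, [p] those of the
    product and [c] the carries.  Schoolbook multiplication produces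
    [p j = (n * e j + c j) %% b]; both [n * e j] and the multiple of [b] that
    the remainder discards vanish modulo [n], so [p j] and [c j] are congruent
    modulo [n].  A carry is always smaller than [n], hence [c j = p j %% n]
    ([mul_carryE]).

    For a permutiple with digits [d] this says that the carry at position [j]
    is [d j %% n], a function of the digit at [j] alone in which the permutation
    does not occur.  In the second permutiple the digit at position [j] is
    [d (pi j)], so its carry there is the carry of the first one at [pi j].

    What remains is to know that the digits delivered by the carry recursion
    are the given ones.  They represent the same number
    ([schoolbook_mulE]), and base [b] digits are unique ([digits_uniq]). *)

(** Comparing the expansions modulo [b] identifies the lowest digits; dividing
    by [b] shifts the others down.  The term [c * b ^ m] makes room for the last
    carry of a multiplication, which [schoolbook_mulE] leaves on the right. *)
Lemma digits_uniq (b m c : nat) (f g : nat -> nat) :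
    (forall i, f i < b) -> (forall i, g i < b) ->
    \sum_(i < m) f i * b ^ i = \sum_(i < m) g i * b ^ i + c * b ^ m ->
  forall i, i < m -> f i = g i.
Proof.
elim: m f g => [//|m IHm] f g ltf ltg.
have b_gt0 : 0 < b by apply: leq_ltn_trans (ltf 0).
have horner (h : nat -> nat) : \sum_(i < m.+1) h i * b ^ i =
    (\sum_(i < m) h i.+1 * b ^ i) * b + h 0.
  rewrite big_ord_recl expn0 muln1 addnC big_distrl; congr (_ + _) => /=.
  by apply: eq_bigr => i _; rewrite expnSr mulnA.
rewrite !horner expnSr mulnA addnAC -mulnDl => eq_fg.
have eq0 : f 0 = g 0.
  by move/(congr1 (modn^~ b)): eq_fg; rewrite !modnMDl !modn_small.
move: eq_fg; rewrite eq0 => /addIn/eqP; rewrite eqn_pmul2r // => /eqP eqS.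
case=> [//|i] lt_im.
by apply: (IHm (f \o succn) (g \o succn)) => /= [x|x||].
Qed.

Section Carries.

Variables (n b k : nat) (e : 'I_k.+1 -> 'I_b).

Let mul_digit i := (n * e (inord i) + mul_carry n e i) %% b.

Lemma base_gt0 : 0 < b.
Proof. exact: leq_ltn_trans (ltn_ord (e ord0)). Qed.

Lemma mul_carryS j :
  mul_carry n e j.+1 = (n * e (inord j) + mul_carry n e j) %/ b.
Proof.
by rewrite /= {1}(divn_eq (_ + mul_carry n e j) b) addnK mulnK ?base_gt0.
Qed.

Lemma mul_carry_lt j : 0 < n -> mul_carry n e j < n.
Proof.
move=> n_gt0; elim: j => [//|j IHj].
rewrite mul_carryS ltn_divLR ?base_gt0 //.
have : n * (e (inord j)).+1 <= n * b by rewrite leq_mul2l ltn_ord orbT.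
by apply: leq_trans; rewrite mulnS addnC ltn_add2r.
Qed.

Lemma schoolbook_mulE m :
  n * (\sum_(i < m) e (inord i) * b ^ i) =
  \sum_(i < m) mul_digit i * b ^ i + mul_carry n e m * b ^ m.
Proof.
elim: m => [|m IHm]; first by rewrite !big_ord0 muln0.
rewrite !big_ord_recr mulnDr IHm mul_carryS [LHS]/= [RHS]/= expnS mulnA.
rewrite -!addnA; congr (_ + _).
by rewrite mulnA -!mulnDl addnC [in RHS]addnC -divn_eq.
Qed.

(** The digit produced at position [j] and the carry entering it are congruent
    modulo [n], because [n] divides both the base and [n * e (inord j)]. *)
Lemma mul_carryE (p : 'I_k.+1 -> 'I_b) (j : 'I_k.+1) :
    0 < n -> n %| b -> digits_value p = n * digits_value e ->
  mul_carry n e j = p j %% n.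
Proof.
move=> n_gt0 n_dvd_b eq_val.
have digits_valueE (q : 'I_k.+1 -> 'I_b) :
    digits_value q = \sum_(i < k.+1) q (inord i) * b ^ i.
  by apply: eq_bigr => i _; rewrite inord_val.
have ltp i : p (inord i) < b by [].
have ltr i : mul_digit i < b by rewrite ltn_pmod ?base_gt0.
move: eq_val; rewrite !digits_valueE schoolbook_mulE.
move/(digits_uniq ltp ltr)/(_ j (ltn_ord j)); rewrite inord_val => ->.
by rewrite /mul_digit modn_dvdm // mulnC modnMDl modn_small ?mul_carry_lt.
Qed.

End Carries.

Theorem theorem16 (n b k : nat) (hn : 1 < n) (hnb : n < b)
    (sigma tau pi : 'S_k.+1) (d : 'I_k.+1 -> 'I_b)
    (hd : permutiple n sigma d)
    (hdpi : permutiple n tau (fun j => d (pi j)))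
    (hdvd : n %| b) :
  forall j : 'I_k.+1,
    permutiple_carry n tau (fun i => d (pi i)) j =
    permutiple_carry n sigma d (pi j).
Proof.
move=> j; have n_gt0 : 0 < n by apply: ltnW.
rewrite /permutiple_carry (mul_carryE _ n_gt0 hdvd hdpi).
by rewrite (mul_carryE _ n_gt0 hdvd hd).
Qed.
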